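(* Let $\alpha$ be an algebraic number of degree $d$. Suppose that the equation $x^x = \alpha$ has a solution $x = a/b$, where $a, b \in \mathbb{N}$ and $\gcd(a,b) = 1$. If $\alpha$ is an algebraic integer then $b = 1$. Otherwise $b \geq 2$ and $$\frac{b}{\log b} \leq \frac{d}{\log 2}.$$
   Context: $\mathbb{N}$ denotes the set of positive integers. The degree of an algebraic number is its degree over $\mathbb{Q}$. For a positive rational number $x$, $x^x$ denotes the positive real number $\exp(x \log x)$. $\log$ is the natural logarithm. *)

(* Defs.v *)
From mathcomp Require Import all_boot all_order all_algebra.
From mathcomp Require Import complex.
From mathcomp Require Import reals exp.

Set Implicit Arguments.
Unset Strict Implicit.
Unset Printing Implicit Defensive.

Import GRing.Theory Num.Theory.

Local Open Scope ring_scope.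
Local Open Scope complex_scope.

Definition is_minimal_polynomial (K : numFieldType) (p : {poly rat}) (z : K) : Prop :=
  [/\ p \is monic, root (map_poly ratr p) z &
      forall q : {poly rat}, q != 0 -> root (map_poly ratr q) z ->
        (size p <= size q)%N].

(* Complex numbers are R[i], over an arbitrary model R of the reals. *)
Definition algebraic_of_degree (R : realType) (d : nat) (alpha : R[i]) : Prop :=
  exists2 p : {poly rat}, is_minimal_polynomial p alpha & size p = d.+1.

Definition algebraic_integer (R : realType) (alpha : R[i]) : Prop :=
  integralOver (intr : int -> R[i]) alpha.

(* Main.v *)
Require Import Defs.
From mathcomp Require Import all_boot all_order all_algebra.
From mathcomp Require Import complex.
From mathcomp Require Import reals exp.

Local Open Scope ring_scope.
Local Open Scope complex_scope.

Import GRing.Theory Num.Theory.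

(** Write [r := (a / b) ^ a], so that [alpha ^ b = r] is rational.

    If [alpha] is an algebraic integer, so is the rational number [r], hence [r]
    is an integer ([rat_integral_is_int]); since [a] and [b] are coprime, this
    forces [b = 1] ([ratio_pow_int]).  Conversely, [b = 1] makes [alpha = a ^ a]
    an integer, so [2 <= b] when [alpha] is not integral.

    For the inequality, take norms.  Every conjugate of [alpha] is also a root of
    [X ^ b - r], so the norm of [alpha], which up to sign is the constant
    coefficient [c] of its minimal polynomial, satisfies [|c| ^ b = r ^ d]
    ([normr_minimal_polynomial_coef0]).  Thus [(a / b) ^ (a d)] is the [b]-th
    power of a rational number.  Comparing the exponents of a prime [q] that
    divides [b], and using that [b] is coprime to [a], yields [b %| d v] for [v]
    the exponent of [q] in [b] ([dvdn_mul_logn_of_rat_root]).  As [d v] is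
    positive, [b <= d v], and [2 ^ v <= q ^ v <= b]; hence
    [2 ^ b <= 2 ^ (d v) <= b ^ d], and the bound follows by taking logarithms. *)

(** The remainder of [q] modulo [p] vanishes at [z] too but has smaller degree
    than [p], so minimality makes it zero. *)
Lemma minimal_polynomial_dvdp (K : numFieldType) (p q : {poly rat}) (z : K) :
  is_minimal_polynomial p z -> root (map_poly ratr q) z -> p %| q.
Proof.
case=> p_monic pz0 p_min qz0.
apply: contraT; rewrite /dvdp => rem_neq0.
have p_neq0 := monic_neq0 p_monic.
suff /(p_min _ rem_neq0) : root (map_poly ratr (q %% p)) z.
  by rewrite leqNgt ltn_modp p_neq0.
move: qz0; rewrite {1}(divp_eq q p) rmorphD rmorphM /root !hornerE.
by rewrite (rootP pz0) mulr0 add0r.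
Qed.

(** The conjugates of [z] are all [n]-th roots of [r], and the constant
    coefficient of [p] is their product up to sign; the absolute values dispose
    of that sign. *)
Lemma normr_minimal_polynomial_coef0 (K : numClosedFieldType) (p : {poly rat})
    (z : K) (n : nat) (r : rat) :
  is_minimal_polynomial p z -> z ^+ n = ratr r ->
  `|p`_0| ^+ n = `|r| ^+ (size p).-1.
Proof.
move=> p_min z_pow.
have p_dvd : p %| 'X^n - r%:P.
  apply: (minimal_polynomial_dvdp _ _ _ _ p_min).
  by rewrite /root rmorphB /= map_polyXn map_polyC /= !hornerE z_pow subrr.
have [p_monic _ _] := p_min.
have [s ps] := closed_field_poly_normal (map_poly (ratr : rat -> K) p).
move: ps; rewrite lead_coef_map (monicP p_monic) rmorph1 scale1r => ps.
have size_s : size s = (size p).-1.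
  by rewrite -(size_map_poly (ratr : {rmorphism rat -> K})) ps size_prod_XsubC.
have s_pow w : w \in s -> w ^+ n = ratr r.
  rewrite -root_prod_XsubC -ps => pw0.
  have : root (map_poly ratr ('X^n - r%:P)) w.
    by case/dvdpP: p_dvd => q ->; rewrite rmorphM rootM pw0 orbT.
  by rewrite /root rmorphB /= map_polyXn map_polyC /= !hornerE subr_eq0 => /eqP.
have ratr_inj : injective (ratr : rat -> K) by exact: fmorph_inj.
(* The left-hand side is the product of the [`|w ^+ n|] for [w] in [s], and
   each of these factors is [`|r|]. *)
apply: ratr_inj; rewrite !rmorphXn /= !ratr_norm.
rewrite -size_s -(coef_map (ratr : {rmorphism rat -> K})) /= ps.
rewrite -horner_coef0 horner_prod normr_prod -prodrXl big_seq.
rewrite (eq_bigr (fun=> `|ratr r : K|)) => [|w ws]; last first.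
  by rewrite !hornerE normrN -normrX s_pow.
by rewrite -big_seq big_const_seq count_predT -Monoid.iteropE.
Qed.

(** By Gauss's lemma, [X - r] is a rational multiple of an integer factor [p1] of
    a monic integer polynomial.  The leading coefficient of [p1] is then
    invertible in the integers, so the multiple is by an integer, and [- r] is an
    integer multiple of the constant coefficient of [p1]. *)
Lemma rat_integral_is_int (K : numFieldType) (r : rat) :
  integralOver (intr : int -> K) (ratr r) -> r \is a Num.int.
Proof.
case=> p p_monic pr0.
have /dvdpP_rat_int[p1 [c c_neq0 Xr] [q p_eq]] :
    'X - r%:P %| map_poly (intr : int -> rat) p.
  rewrite dvdp_XsubCl -(fmorph_root (ratr : {rmorphism rat -> K})).
  rewrite -map_poly_comp (eq_map_poly (g := intr)) // => i.
  exact: ratr_int.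
have lead1 : lead_coef p1 * lead_coef q = 1.
  by rewrite -lead_coefM -p_eq (monicP p_monic).
have clead : c * (lead_coef p1)%:~R = 1.
  rewrite -(lead_coef_map_inj (@intr_inj rat)) // -lead_coefZ -Xr.
  by rewrite lead_coefXsubC.
have c_int : c = (lead_coef q)%:~R.
  have lead1_rat : (lead_coef p1)%:~R * (lead_coef q)%:~R = 1 :> rat.
    by rewrite -intrM lead1.
  by rewrite -[LHS]mulr1 -[X in c * X]lead1_rat mulrA clead mul1r.
have /(congr1 (fun f : {poly rat} => - f`_0)) := Xr.
rewrite coefB coefX coefC coefZ coef_map /= sub0r opprK c_int => ->.
by rewrite -rmorphM -rmorphN /= intr_int.
Qed.

(** If [q] is a prime factor of [b] then it does not divide [a], so comparing the
    exponents of [q] gives [b * logn q m + a * d * logn q b = b * logn q n]; the factor [a]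
    is then cancelled because it is coprime to [b]. *)
Lemma dvdn_mul_logn_of_nat_root (a b d m n q : nat) :
  coprime a b -> (0 < m)%N -> (0 < n)%N -> (0 < a)%N -> (0 < b)%N ->
  (m ^ b * b ^ (a * d) = n ^ b * a ^ (a * d))%N ->
  (b %| d * logn q b)%N.
Proof.
move=> coprime_ab m_gt0 n_gt0 a_gt0 b_gt0 eq_pow.
case: (boolP (q \in primes b)) => [|q_nprimes]; last first.
  by move: q_nprimes; rewrite -logn_gt0 -eqn0Ngt => /eqP->; rewrite muln0.
rewrite mem_primes => /and3P[q_prime _ q_dvd_b].
have logn_a : logn q a = 0%N.
  apply: logn_coprime; rewrite prime_coprime //; apply/negP => q_dvd_a.
  have : (q %| gcdn a b)%N by rewrite dvdn_gcd q_dvd_a.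
  by rewrite (eqP coprime_ab) dvdn1 => /eqP q1; rewrite q1 in q_prime.
have /(congr1 (logn q)) := eq_pow.
rewrite !lognM ?expn_gt0 ?m_gt0 ?n_gt0 ?a_gt0 ?b_gt0 // !lognX logn_a.
rewrite muln0 addn0 => eq_log.
have : (b %| a * (d * logn q b))%N.
  have := dvdn_mulr (logn q n) (dvdnn b).
  by rewrite -eq_log dvdn_addr; [rewrite mulnA | apply: dvdn_mulr].
by rewrite Gauss_dvdr // coprime_sym.
Qed.

(** Writing [`|c| = m / n] and clearing denominators reduces the equation to one
    between natural numbers. *)
Lemma dvdn_mul_logn_of_rat_root (a b d q : nat) (c : rat) :
  coprime a b -> (0 < a)%N -> (0 < b)%N ->
  `|c| ^+ b = `|(a%:R / b%:R) ^+ a| ^+ d ->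
  (b %| d * logn q b)%N.
Proof.
move=> coprime_ab a_gt0 b_gt0 c_pow.
have bR_neq0 : b%:R != 0 :> rat by rewrite pnatr_eq0 -lt0n.
have c_neq0 : c != 0.
  apply: contra_eq_neq c_pow => ->; rewrite normr0 expr0n gtn_eqF //= eq_sym.
  by rewrite !expf_neq0 // normr_eq0 expf_neq0 // mulf_neq0 ?invr_eq0 // pnatr_eq0 -lt0n.
apply: (@dvdn_mul_logn_of_nat_root a b d `|numq c|%N `|denq c|%N) => //.
- by rewrite absz_gt0 numq_eq0.
- by rewrite absz_gt0 denq_neq0.
apply/eqP; rewrite -(eqr_nat rat) !natrM !natrX !natr_absz.
have -> : (`|numq c|%:~R : rat) = `|c| * `|denq c|%:~R.
  by rewrite !intr_norm -normrM -{2}(divq_num_den c) divfK // intr_eq0 denq_neq0.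
rewrite exprMn c_pow normrX ger0_norm ?divr_ge0 ?ler0n // -exprM exprMn exprVn.
by rewrite mulrAC divfK ?expf_neq0 // mulrC.
Qed.

Lemma self_powR_ratio_expr (R : realType) (a b : nat) : (0 < b)%N ->
  ((a%:R / b%:R : R) `^ (a%:R / b%:R)) ^+ b = (a%:R / b%:R) ^+ a.
Proof.
move=> b_gt0.
rewrite -powR_mulrn ?powR_ge0 // -powRrM divfK ?pnatr_eq0 -?lt0n //.
by rewrite powR_mulrn // divr_ge0 ?ler0n.
Qed.

Lemma ratio_pow_int (a b : nat) : (0 < a)%N -> (0 < b)%N -> coprime a b ->
  (a%:R / b%:R : rat) ^+ a \is a Num.int -> b = 1%N.
Proof.
move=> a_gt0 b_gt0 coprime_ab /intrP[k].
move/(congr1 (fun u : rat => u * b%:R ^+ a)).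
rewrite exprMn exprVn divfK ?expf_neq0 ?pnatr_eq0 -?lt0n // => eq_k.
have : (b ^ a %| a ^ a)%N.
  suff : (Posz (b ^ a) %| Posz (a ^ a))%Z by [].
  apply/dvdzP; exists k; apply: (@intr_inj rat).
  by rewrite rmorphM /= -!pmulrn !natrX.
have /eqP := coprimeXl a (coprimeXr a coprime_ab).
move=> /[swap] /gcdn_idPl; rewrite gcdnC => -> /eqP.
by move=> pow1; apply/eqP; rewrite -(eqn_exp2r _ _ a_gt0) exp1n.
Qed.

Theorem theorem2p4 (R : realType) (alpha : R[i]) (d : nat)
    (alpha_deg : algebraic_of_degree d alpha)
    (x : R) (a b : nat) (a_gt0 : (0 < a)%N) (b_gt0 : (0 < b)%N)
    (coprime_ab : coprime a b) (x_def : x = a%:R / b%:R)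
    (x_sol : (x `^ x)%:C = alpha) :
  (algebraic_integer alpha -> b = 1%N) /\
  (~ algebraic_integer alpha ->
     (2 <= b)%N /\ (b%:R / ln (b%:R : R) <= d%:R / ln (2%:R : R))).
Proof.
pose r : rat := (a%:R / b%:R) ^+ a.
have alpha_pow : alpha ^+ b = ratr r.
  rewrite -x_sol x_def -rmorphXn /= self_powR_ratio_expr // /r.
  by rewrite !(rmorphXn, rmorphM, fmorphV) /= !rmorph_nat.
split=> [alpha_int | alpha_nint].
  apply: (ratio_pow_int a b) => //; apply: (rat_integral_is_int R[i]).
  rewrite -/r -alpha_pow; elim: (b) => [|k IHk]; first exact: integral1.
  by rewrite exprS; apply: integral_mul.
have b_ge2 : (2 <= b)%N.
  rewrite ltnNge; apply/negP => b_le1; apply: alpha_nint.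
  have b1 : b = 1%N by apply/eqP; rewrite eqn_leq b_le1.
  move: alpha_pow; rewrite /r b1 divr1 expr1 rmorphXn /= rmorph_nat -natrX => ->.
  exact: integral_nat.
split=> //.
have [p p_min size_p] := alpha_deg.
have norm_p0 : `|p`_0| ^+ b = `|r| ^+ d.
  by rewrite (normr_minimal_polynomial_coef0 _ _ _ _ _ p_min alpha_pow) size_p.
have d_gt0 : (0 < d)%N.
  case: p_min => p_monic pz0 _.
  have := root_size_gt1 _ pz0.
  by rewrite size_map_poly size_p; apply; rewrite map_poly_eq0 monic_neq0.
have q_prime := pdiv_prime b_ge2; set q := pdiv b in q_prime.
have v_gt0 : (0 < logn q b)%N by rewrite logn_gt0 mem_primes q_prime b_gt0 pdiv_dvd.
have b_le : (b <= d * logn q b)%N.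
  by rewrite dvdn_leq ?muln_gt0 ?d_gt0 //; apply: dvdn_mul_logn_of_rat_root norm_p0.
(* Clearing the denominators [ln b] and [ln 2] turns the bound into
   [ln (2 ^ b) <= ln (b ^ d)]. *)
have two_pow : (2 ^ b <= b ^ d)%N.
  apply: (@leq_trans (2 ^ (d * logn q b))); first by rewrite leq_exp2l.
  rewrite mulnC expnM leq_exp2r //.
  apply: leq_trans (dvdn_leq b_gt0 (pfactor_dvdnn q b)).
  by rewrite leq_exp2r // prime_gt1.
have ln_gt0 n : (2 <= n)%N -> 0 < ln (n%:R : R).
  by move=> n_ge2; rewrite ln_gt0 // ltr1n.
rewrite ler_pdivrMr ?ln_gt0 // mulrAC ler_pdivlMr ?ln_gt0 //.
rewrite !mulr_natl -!lnXn ?ltr0n // -!natrX ler_ln ?posrE ?ltr0n ?expn_gt0 ?b_gt0 //.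
by rewrite ler_nat.
Qed.
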